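(* (1) Let $G$ be a finite group and $N$ a nontrivial abelian normal subgroup of $G$. If $I_G(\mu)/N$ is cyclic for all $\mu\in\mathrm{Irr}(N)$, then $G$ is unramified over $N$. In particular, if $G/N$ is cyclic, then $G$ is unramified over $N$. (2) Every finite metacyclic group is totally unramified.
   Context: All representations and characters are complex. For a normal subgroup $N$ of $G$ and $\mu\in\mathrm{Irr}(N)$, put ${}^g\mu(n)=\mu(g^{-1}ng)$; the inertia subgroup is $I_G(\mu)=\{g\in G\mid {}^g\mu=\mu\}$. A representation is multiplicity free if it is a direct sum of pairwise non-equivalent irreducible representations; a restriction $\rho|_N$ is called trivial if every element of $N$ acts as the identity. A finite group $G$ is unramified over a nontrivial abelian normal subgroup $N$ if for every irreducible representation $\rho$ of $G$ the restriction $\rho|_N$ is multiplicity free or trivial. A finite group $G$ is totally unramified (recursively) if it is abelian or there exists a nontrivial abelian normal subgroup $N$ such that $G$ is unramified over $N$ and $G/N$ is totally unramified. A group is metacyclic if it has a cyclic normal subgroup with cyclic quotient. *)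

(* Defs.v *)
From HB Require Import structures.
From mathcomp Require Import all_boot all_order all_fingroup all_algebra.
From mathcomp Require Import all_solvable all_character.
From mathcomp Require Import complex reals.

Set Implicit Arguments.
Unset Strict Implicit.
Unset Printing Implicit Defensive.

Import GroupScope GRing.Theory.
Local Open Scope ring_scope.

(* Everything below is over an arbitrary field F; complex representations are
   those with F := R[i] for R : realType. The library's 'CF(N), irr N and
   'I_G[_] are not used because they are tied to the algebraic numbers algC. *)

Section Representations.
Variables (F : fieldType) (gT : finGroupType).
Implicit Types G N : {group gT}.

(* Values of mu outside N are irrelevant. *)
Definition is_irr_char N (mu : gT -> F) : Prop :=
  exists n (rN : mx_representation F N n),
    mx_irreducible rN /\ {in N, forall x, mu x = \tr (rN x)}.

(* x ^ g is g^-1 * x * g. *)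
Definition conj_char (g : gT) (mu : gT -> F) : gT -> F :=
  fun x => mu (x ^ g)%g.

Definition inertia_subgroup G N (mu : gT -> F) : {set gT} :=
  [set g in G | [forall x in N, conj_char g mu x == mu x]].

Definition multiplicity_free G n (rG : mx_representation F G n) : Prop :=
  exists k (U : 'I_k -> 'M[F]_n),
    [/\ forall i, mxsimple rG (U i),
        (\sum_i U i :=: 1%:M)%MS,
        mxdirect (\sum_i U i)
      & forall i j, i != j -> ~ mx_iso rG (U i) (U j)].

Definition trivial_repr G n (rG : mx_representation F G n) : Prop :=
  {in G, forall x, rG x = 1%:M}.

Definition unramified G N : Prop :=
  [/\ N :!=: 1%g, abelian N, N <| G
    & forall (sNG : N \subset G) n (rG : mx_representation F G n),
        mx_irreducible rG ->
        multiplicity_free (subg_repr rG sNG) \/ trivial_repr (subg_repr rG sNG)].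

End Representations.

Inductive totally_unramified (F : fieldType) :
    forall gT : finGroupType, {group gT} -> Prop :=
| TotallyUnramifiedAbelian (gT : finGroupType) (G : {group gT}) :
    abelian G -> totally_unramified F G
| TotallyUnramifiedQuotient (gT : finGroupType) (G N : {group gT}) :
    unramified F G N -> totally_unramified F (G / N)%G ->
    totally_unramified F G.

(* Main.v *)
(** Let [rho] be an irreducible representation of [G] and [M] a simple
    [N]-submodule, so that [N] acts on the line [M] by a character [mu]. The
    inertia group [I] of [mu] stabilises the [mu]-eigenspace [V] of [N]; if [I / N] is
    generated by the coset of [x], any eigenvector of [x] in [V] spans an
    [I]-stable line [U]. By irreducibility the [G]-translates of [U] span, and two of
    them on which [N] acts by the same character differ by an element of [I], so
    they coincide; a direct sum of translates is hence multiplicity free. *)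
Require Import Defs.
From HB Require Import structures.
From mathcomp Require Import all_boot all_order all_fingroup all_algebra.
From mathcomp Require Import all_solvable all_character.
From mathcomp Require Import complex reals.

Set Implicit Arguments.
Unset Strict Implicit.
Unset Printing Implicit Defensive.

Import GroupScope GRing.Theory.
Local Open Scope ring_scope.

Section Inertia.
Context {F : fieldType} {gT : finGroupType} {G N : {group gT}}.
Hypothesis nsNG : N <| G.
Implicit Type mu : gT -> F.

Lemma inertiaP mu (y : gT) :
  reflect (y \in G /\ {in N, forall h, mu (h ^ y)%g = mu h})
          (y \in inertia_subgroup G N mu).
Proof.
rewrite inE; apply: (iffP andP) => -[Gy muy]; split=> //.
  by move=> h Nh; move/forall_inP/(_ h Nh)/eqP: muy.
by apply/forall_inP=> h Nh; apply/eqP/muy.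
Qed.

Lemma inertia_group_set mu : group_set (inertia_subgroup G N mu).
Proof.
apply/group_setP; split.
  by apply/inertiaP; split=> // h _; rewrite conjg1.
move=> y z /inertiaP[Gy muy] /inertiaP[Gz muz]; apply/inertiaP.
split=> [|h Nh]; first exact: groupM.
by rewrite conjgM muz ?muy // memJ_norm // (subsetP (normal_norm nsNG)).
Qed.

Lemma cyclic_inertia_quotient mu :
  cyclic (G / N)%g -> cyclic (inertia_subgroup G N mu / N)%g.
Proof.
(* [inertia_subgroup] is only a set; as a group, its image in [G / N] falls under [cyclicS]. *)
pose I := Group (inertia_group_set mu).
have sIG: I \subset G by apply/subsetP=> y /inertiaP[].
exact: cyclicS (quotientS N sIG).
Qed.

End Inertia.

Section EigenLines.
Context {F : fieldType} {gT : finGroupType} {G N : {group gT}} {n : nat}.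
Variable rG : mx_representation F G n.
Hypothesis nsNG : N <| G.
Let sNG := normal_sub nsNG.
Implicit Type mu : gT -> F.

Definition acts_by m (W : 'M_(m, n)) mu :=
  {in N, forall h, W *m rG h = mu h *: W}.

Lemma acts_by_mull m p (D : 'M_(p, m)) (W : 'M_(m, n)) mu :
  acts_by W mu -> acts_by (D *m W) mu.
Proof. by move=> muW h Nh; rewrite -mulmxA muW // scalemxAr. Qed.

(** [G] acts on row vectors from the right and [rG y *m rG h] is [rG (h ^ y^-1) *m rG y], so
    translating by [y] twists the character by [y^-1]. *)
Lemma acts_by_translate m (W : 'M_(m, n)) mu (y : gT) :
  y \in G -> acts_by W mu -> acts_by (W *m rG y) (conj_char y^-1 mu).
Proof.
move=> Gy muW h Nh; have Gh := subsetP sNG h Nh.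
rewrite -mulmxA -repr_mxM // conjgCV repr_mxM ?groupJ ?groupV // mulmxA.
rewrite muW -?scalemxAl // memJ_norm // (subsetP (normal_norm nsNG)) //.
by rewrite groupV.
Qed.

Lemma acts_by_module (U : 'M_n) mu :
  acts_by U mu -> mxmodule (subg_repr rG sNG) U.
Proof. by move=> muU; apply/mxmoduleP=> h /muU /= ->; apply: scalemx_sub. Qed.

(** The nonzero matrix [U *m f] is scaled by [mu h] because [f] commutes with [N], and by [nu h]
    because its rows lie in [V]. *)
Lemma acts_by_iso (U V : 'M_n) mu nu :
    U != 0 -> acts_by U mu -> acts_by V nu ->
    mx_iso (subg_repr rG sNG) U V -> {in N, mu =1 nu}.
Proof.
move=> nzU muU nuV [f injf /hom_mxP homf defV] h Nh.
have /submxP[D defUf]: (U *m f <= V)%MS by rewrite defV.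
have nzUf: U *m f != 0 by rewrite mulmx_free_eq0 // row_free_unit.
have: mu h *: (U *m f) = nu h *: (U *m f).
  rewrite [in RHS]defUf -(acts_by_mull _ nuV) // -defUf.
  by have /= <- := homf h Nh; rewrite muU // scalemxAl.
move/eqP; rewrite -subr_eq0 -scalerBl scaler_eq0 (negPf nzUf) orbF subr_eq0.
by move/eqP.
Qed.

Definition eigenspace_of mu := (\bigcap_(h in N) eigenspace (rG h) (mu h))%MS.

Lemma eigenspace_ofP m (W : 'M_(m, n)) mu :
  reflect (acts_by W mu) (W <= eigenspace_of mu)%MS.
Proof.
by apply: (iffP sub_bigcapmxP) => muW h /muW; [move/eigenspaceP | move=> ?; apply/eigenspaceP].
Qed.

Lemma eigenspace_of_inertia mu (y : gT) :
  y \in inertia_subgroup G N mu ->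
  (eigenspace_of mu *m rG y <= eigenspace_of mu)%MS.
Proof.
case/inertiaP=> Gy muy; apply/eigenspace_ofP=> h Nh.
rewrite (acts_by_translate _ (mu := mu)) //; last exact/eigenspace_ofP.
rewrite /conj_char -[in LHS]muy ?conjgKV // memJ_norm //.
by rewrite (subsetP (normal_norm nsNG)) ?groupV.
Qed.

(** A 1-by-1 matrix is its trace times the identity. The trace form matches what [is_irr_char] asks
    for. *)
Lemma acts_by_submod_trace (M : 'M_n) (modM : mxmodule (subg_repr rG sNG) M) :
  \rank M = 1%N -> acts_by M (fun h => \tr (submod_repr modM h)).
Proof.
move=> rM1 h Nh.
(* The size [\rank M] is not convertible to 1, hence the generalisation over [k]. *)
have scal k (A : 'M[F]_k) : k = 1%N -> A = (\tr A)%:M.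
  by case: k A => [|[]] // A _; rewrite [A]mx11_scalar mxtrace_scalar.
have := val_submodJ modM (in_submod M M) Nh.
rewrite in_submodK // => /= <-.
by rewrite {1}[submod_repr modM h]scal // mul_mx_scalar linearZ /= in_submodK.
Qed.

(** [Clifford_basis] provides translates of [U] in direct sum; an isomorphism between two distinct
    ones would put one inside the other, against directness. *)
Lemma multiplicity_free_translates (U : 'M_n) mu :
    mx_irreducible rG -> \rank U = 1%N -> acts_by U mu ->
    inertia_subgroup G N mu \subset rstabs rG U ->
  multiplicity_free (subg_repr rG sNG).
Proof.
move=> irrG rU1 muU stU.
have modU := acts_by_module muU; have simU := linear_mxsimple modU rU1.
have [X /subsetP sXG [defX dxX]] := Clifford_basis irrG simU.
have GX (i : 'I_#|X|) : enum_val i \in G by apply/sXG/enum_valP.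
(* [multiplicity_free] wants summands indexed by an ordinal, so [X] is enumerated. *)
have eqS : (\sum_(i < #|X|) U *m rG (enum_val i) :=: \sum_(x in X) U *m rG x)%MS.
  apply/eqmxP/andP; split; apply/sumsmx_subP.
    by move=> i _; apply: (sumsmx_sup (enum_val i)); rewrite ?enum_valP.
  move=> x Xx; apply: (sumsmx_sup (enum_rank_in Xx x)) => //.
  by rewrite enum_rankK_in.
exists #|X|, (fun i => U *m rG (enum_val i)); split.
- by move=> i; apply: Clifford_simple.
- exact: eqmx_trans defX.
- by rewrite mxdirectE /= eqS (mxdirectP dxX) /= big_enum_val.
move=> i j ne_ij.
set x := enum_val i; set y := enum_val j => isoxy.
have Gx: x \in G := GX i; have Gy: y \in G := GX j.
have nzU: U != 0 by rewrite -mxrank_eq0 rU1.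
have nzUx: U *m rG x != 0.
  by rewrite mulmx_free_eq0 // row_free_unit repr_mx_unit.
have eq_mu := acts_by_iso nzUx (acts_by_translate Gx muU)
  (acts_by_translate Gy muU) isoxy.
have Ixy: (x * y^-1)%g \in inertia_subgroup G N mu.
  apply/inertiaP; split=> [|h Nh]; first by rewrite groupM ?groupV.
  have Nhx: (h ^ x)%g \in N by rewrite memJ_norm // (subsetP (normal_norm nsNG)).
  (* At [h ^ x], the equality of the two twisted characters reads [mu h = mu (h ^ (x * y^-1))]. *)
  by have:= eq_mu _ Nhx; rewrite /conj_char conjgK conjgM => ->.
have sUxy: (U *m rG x <= U *m rG y)%MS.
  have /(subsetP stU) := Ixy; rewrite inE => /andP[_ sU].
  by rewrite -[x](mulgKV y) repr_mxM ?groupM ?groupV // mulmxA submxMr.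
case/negP: nzUx; rewrite -submx0.
have neXyx: y != x by rewrite (inj_eq enum_val_inj) eq_sym.
have Xx: x \in X by apply: enum_valP.
have Xy: y \in X by apply: enum_valP.
have /mxdirect_sumsP/(_ x Xx) <- := dxX.
by rewrite sub_capmx submx_refl (sumsmx_sup y) // Xy.
Qed.

End EigenLines.

Lemma unramified_cyclic_inertia (F : closedFieldType) (gT : finGroupType)
    (G N : {group gT}) :
  N :!=: 1%g -> abelian N -> N <| G ->
  (forall mu : gT -> F, is_irr_char N mu ->
     cyclic (inertia_subgroup G N mu / N)%g) ->
  unramified F G N.
Proof.
move=> ntN abN nsNG cycI; split=> // sNG n rG irrG; left.
(* [unramified] quantifies over the inclusion proof; it is replaced by the one used in the lemmas on
   eigenlines. *)
have -> : sNG = normal_sub nsNG by apply: bool_irrelevance.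
set rN := subg_repr rG _.
have nz1: (1%:M : 'M[F]_n) != 0 by case: irrG.
have [M simM _] := dec_mxsimple_exists (mxmodule1 rN) nz1.
have [modM nzM _] := simM.
have rM1 : \rank M = 1%N.
  apply: (mxsimple_abelian_linear _ abN simM).
  exact: group_closure_closed_field.
pose mu := fun h => \tr (submod_repr modM h).
have muM := acts_by_submod_trace modM rM1.
have irr_mu: is_irr_char N mu.
  by exists (\rank M), (submod_repr modM); split=> //; apply/submod_mx_irr.
have /cyclicP[xb defxb] := cycI mu irr_mu.
have /morphimP[x Nx Ix def_xb]: xb \in (inertia_subgroup G N mu / N)%g.
  by rewrite defxb cycle_id.
have [Gx _] := inertiaP _ _ Ix.
have sXG: <[x]> \subset G by rewrite gen_subG sub1set.
pose V := eigenspace_of (N := N) rG mu.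
have sMV: (M <= V)%MS by apply/eigenspace_ofP.
have nzV: V != 0 by apply: contraNneq nzM => V0; rewrite -submx0 -V0.
have modV: mxmodule (subg_repr rG sXG) V.
  rewrite /mxmodule rstabs_subg subsetI subxx gen_subG sub1set inE Gx /=.
  exact: eigenspace_of_inertia.
(* A simple submodule of [V] under the abelian group [<[x]>] is a line over a closed field: this is
   the eigenvector of [x]. *)
have [U simU sUV] := dec_mxsimple_exists modV nzV.
have rU1 : \rank U = 1%N.
  apply: (mxsimple_abelian_linear _ (cycle_abelian x) simU).
  exact: group_closure_closed_field.
have muU : acts_by (N := N) rG U mu by apply/eigenspace_ofP.
apply: (multiplicity_free_translates nsNG irrG rU1 muU).
have stN: N \subset rstabs rG U.
  by have := acts_by_module nsNG muU; rewrite /mxmodule rstabs_subg subsetI subxx.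
have stx: <[x]> \subset rstabs rG U.
  by have [] := simU; rewrite /mxmodule rstabs_subg subsetI subxx.
apply/subsetP=> y Iy; have [Gy _] := inertiaP _ _ Iy.
have Ny := subsetP (normal_norm nsNG) y Gy.
(* Every [y] in the inertia group is some [h * x ^+ k] with [h] in [N], and both factors stabilise
   [U]. *)
have: coset N y \in <[xb]>%g by rewrite -defxb; apply: mem_morphim.
rewrite def_xb => /cycleP[k]; rewrite -morphX // => eq_yxk.
have /rcosetP[h Nh ->]: y \in (N :* (x ^+ k))%g.
  by apply/rcoset_kercosetP; rewrite ?groupX.
by rewrite groupM //; [apply: (subsetP stN) | apply/(subsetP stx)/mem_cycle].
Qed.

Theorem corollary5p11 (R : realType) :
  (forall (gT : finGroupType) (G N : {group gT}),
     N :!=: 1%g -> abelian N -> N <| G ->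
     ((forall mu : gT -> R[i], is_irr_char N mu ->
         cyclic (inertia_subgroup G N mu / N)%g) ->
      unramified R[i] G N)
     /\ (cyclic (G / N)%g -> unramified R[i] G N))
  /\ (forall (gT : finGroupType) (G : {group gT}),
        metacyclic G -> totally_unramified R[i] G).
Proof.
have unram gT (G N : {group gT}) : N :!=: 1%g -> abelian N -> N <| G ->
    cyclic (G / N)%g -> unramified R[i] G N.
  move=> ntN abN nsNG cycGN; apply: unramified_cyclic_inertia => // mu _.
  exact: cyclic_inertia_quotient.
split=> [gT G N ntN abN nsNG | gT G /metacyclicP[K [cycK nsKG cycGK]]].
  by split; [apply: unramified_cyclic_inertia | apply: unram].
(* [unramified] demands a nontrivial subgroup. If [K] is trivial, [G] is isomorphic to the cyclic
   group [G / K], hence abelian. *)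
have [K1 | ntK] := eqVneq (K : {set gT}) 1%g.
  apply/TotallyUnramifiedAbelian/cyclic_abelian.
  by rewrite (isog_cyclic (quotient1_isog G)) -K1.
apply: (@TotallyUnramifiedQuotient _ _ _ K).
  by apply: unram => //; apply: cyclic_abelian.
exact/TotallyUnramifiedAbelian/cyclic_abelian.
Qed.
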